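(* Let $\Bbbk$ be an algebraically closed field of characteristic zero, let $n\ge1$, and let $\sigma=(1\ 2)(3\ 4)\cdots(2n-1\ \ 2n)\in\mathcal S_{2n}$ act on $V_{2n}$ by permuting the generators. Then $\mathsf p(V_{2n},\langle\sigma\rangle)=2n$.
   Context: $V_m$ is the $\Bbbk$-algebra generated by $x_1,\dots,x_m$ with relations $x_ix_j+x_jx_i=0$ for $i\neq j$; a permutation $\sigma$ acts by the algebra automorphism with $\sigma(x_i)=x_{\sigma(i)}$. For a finite group $G$ acting on $A$, the skew group algebra $A\#G$ is $A\otimes \Bbbk G$ as a vector space with multiplication $(a\# g)(b\# h)=a\,g(b)\# gh$. With $f_G=\sum_{g\in G}1\#g$ and $(f_G)$ the two-sided ideal of $A\#G$ it generates, the pertinency is $\mathsf p(A,G)=\operatorname{GKdim}A-\operatorname{GKdim}\,(A\#G)/(f_G)$, where $\operatorname{GKdim}$ is Gelfand-Kirillov dimension. *)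

(* Defs.v *)
From HB Require Import structures.
From mathcomp Require Import all_boot all_order all_algebra all_fingroup.
From mathcomp Require Import generic_quotient ring_quotient.
From mathcomp Require Import boolp classical_sets reals ereal topology.
From mathcomp Require Import normedtype sequences exp.
(* The notations of monalg are incompatible with those of mathcomp-analysis. *)
From mathcomp Require Import -(notations) monalg.

Set Implicit Arguments.
Unset Strict Implicit.
Unset Printing Implicit Defensive.

Import Order.TTheory GRing.Theory Num.Theory.

Local Open Scope classical_set_scope.
Local Open Scope quotient_scope.
Local Open Scope ring_scope.

(* Unital associative k-algebras, as rings with a structural ring morphism from
   k onto a central subring; the scalar c acts as multiplication by [inalg c].
   The library's [algType] does not fit, as it requires 1 != 0 and a quotient by
   a two-sided ideal may be the zero algebra. *)
HB.mixin Record isAssocAlgebra (k : fieldType) A of GRing.PzRing A := {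
  inalg : k -> A;
  inalg_zmod : zmod_morphism inalg;
  inalg_monoid : monoid_morphism inalg;
  inalg_central : forall (c : k) (a : A), inalg c * a = a * inalg c
}.

#[short(type="assocAlgType")]
HB.structure Definition AssocAlgebra (k : fieldType) :=
  {A of GRing.PzRing A & isAssocAlgebra k A}.

HB.instance Definition _ (k : fieldType) (A : assocAlgType k) :=
  GRing.isZmodMorphism.Build k A (@inalg k A) (@inalg_zmod k A).
HB.instance Definition _ (k : fieldType) (A : assocAlgType k) :=
  GRing.isMonoidMorphism.Build k A (@inalg k A) (@inalg_monoid k A).

Section Ideal.
Variables (k : fieldType) (A : assocAlgType k) (S : set A).

Definition two_sided_ideal (I : set A) : Prop :=
  [/\ I 0, forall x y, I x -> I y -> I (x - y),
      forall a x, I x -> I (a * x) & forall a x, I x -> I (x * a)].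

Definition ideal_gen : set A := smallest two_sided_ideal S.

Lemma ideal_genP x :
  ideal_gen x <-> (forall I, two_sided_ideal I -> S `<=` I -> I x).
Proof. by split=> [Ix I hI hS|Ix I [hI hS]]; [apply: Ix|apply: Ix]. Qed.

Lemma ideal_gen_ideal : two_sided_ideal ideal_gen.
Proof.
split.
- by apply/ideal_genP => I [].
- move=> x y /ideal_genP Ix /ideal_genP Iy; apply/ideal_genP => I hI hS.
  by case: (hI) => _ hB _ _; apply: hB; [apply: Ix|apply: Iy].
- move=> a x /ideal_genP Ix; apply/ideal_genP => I hI hS.
  by case: (hI) => _ _ hl _; apply: hl; apply: Ix.
- move=> a x /ideal_genP Ix; apply/ideal_genP => I hI hS.
  by case: (hI) => _ _ _ hr; apply: hr; apply: Ix.
Qed.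

Definition ideal_pred : {pred A} := fun x => `[< ideal_gen x >].

Lemma ideal_predP x : reflect (ideal_gen x) (x \in ideal_pred).
Proof. exact: asboolP. Qed.

Lemma ideal_pred_zmod_closed : zmod_closed ideal_pred.
Proof.
have [h0 hB _ _] := ideal_gen_ideal.
by split=> [|x y /ideal_predP Ix /ideal_predP Iy]; apply/ideal_predP; auto.
Qed.

HB.instance Definition _ :=
  GRing.isZmodClosed.Build A ideal_pred ideal_pred_zmod_closed.

(* A / (S), for the two-sided ideal (S) generated by S. *)
Definition alg_quot := Quotient.quot ideal_pred.

HB.instance Definition _ := GRing.Zmodule.on alg_quot.

Definition qpi (x : A) : alg_quot := \pi_(Quotient.quot ideal_pred) x.
Definition qrepr (u : alg_quot) : A := generic_quotient.repr u.

Lemma qreprK : cancel qrepr qpi.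
Proof. exact: reprK. Qed.

Lemma qpi_eq x y : reflect (qpi x = qpi y) (x - y \in ideal_pred).
Proof. by rewrite Quotient.idealrBE; exact: eqP. Qed.

Lemma qpiD x y : qpi (x + y) = qpi x + qpi y.
Proof. by rewrite /qpi !piE. Qed.

Definition qone : alg_quot := qpi 1.
Definition qmul (u v : alg_quot) : alg_quot := qpi (qrepr u * qrepr v).

Lemma qpiM x y : qpi (x * y) = qmul (qpi x) (qpi y).
Proof.
have [h0 hB hl hr] := ideal_gen_ideal.
have Ix : ideal_gen (x - qrepr (qpi x)).
  by apply/ideal_predP/qpi_eq; rewrite qreprK.
have Iy : ideal_gen (y - qrepr (qpi y)).
  by apply/ideal_predP/qpi_eq; rewrite qreprK.
apply/qpi_eq/ideal_predP.
have -> : x * y - qrepr (qpi x) * qrepr (qpi y) =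
    x * (y - qrepr (qpi y)) - (0 - (x - qrepr (qpi x)) * qrepr (qpi y)).
  by rewrite sub0r opprK mulrBr mulrBl addrA subrK.
by apply: (hB); [apply: hl|apply: hB => //; apply: hr].
Qed.

Fact qmulA : associative qmul.
Proof.
by move=> u v w; rewrite -[u]qreprK -[v]qreprK -[w]qreprK -!qpiM mulrA.
Qed.
Fact qmul1 : left_id qone qmul.
Proof. by move=> u; rewrite -[u]qreprK -qpiM mul1r. Qed.
Fact qmulr1 : right_id qone qmul.
Proof. by move=> u; rewrite -[u]qreprK -qpiM mulr1. Qed.
Fact qmulDl : left_distributive qmul +%R.
Proof.
move=> u v w; rewrite -[u]qreprK -[v]qreprK -[w]qreprK.
by rewrite -qpiD -!qpiM -qpiD mulrDl.
Qed.
Fact qmulDr : right_distributive qmul +%R.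
Proof.
move=> u v w; rewrite -[u]qreprK -[v]qreprK -[w]qreprK.
by rewrite -qpiD -!qpiM -qpiD mulrDr.
Qed.

HB.instance Definition _ := GRing.Zmodule_isPzRing.Build alg_quot
  qmulA qmul1 qmulr1 qmulDl qmulDr.

Definition qinalg (c : k) : alg_quot := qpi (inalg c).

Fact qinalg_zmod : zmod_morphism qinalg.
Proof. by move=> c d; rewrite /qinalg raddfB /= /qpi !piE. Qed.
Fact qinalg_monoid : monoid_morphism qinalg.
Proof.
split=> [|c d]; first by rewrite /qinalg rmorph1.
by rewrite /qinalg rmorphM qpiM.
Qed.
Fact qinalg_central (c : k) (u : alg_quot) : qinalg c * u = u * qinalg c.
Proof.
by rewrite -[u]qreprK /qinalg -[LHS]qpiM -[RHS]qpiM inalg_central.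
Qed.

HB.instance Definition _ := isAssocAlgebra.Build k alg_quot
  qinalg_zmod qinalg_monoid qinalg_central.

Fact qpi_zmod : zmod_morphism qpi.
Proof. by move=> x y; rewrite /qpi !piE. Qed.
Fact qpi_monoid : monoid_morphism qpi.
Proof. by split=> [|x y]; [|exact: qpiM]. Qed.

HB.instance Definition _ := GRing.isZmodMorphism.Build A alg_quot qpi qpi_zmod.
HB.instance Definition _ :=
  GRing.isMonoidMorphism.Build A alg_quot qpi qpi_monoid.

Lemma qpi_inalg (c : k) : qpi (inalg c) = inalg c.
Proof. by []. Qed.

End Ideal.

Section SkewGroupAlgebra.
Variables (k : fieldType) (A : assocAlgType k) (gT : finGroupType).

(* Left actions of a finite group by k-algebra automorphisms (bijectivity
   follows from the action axioms). *)
Record alg_action := AlgAction {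
  alg_act :> gT -> A -> A;
  alg_act_zmod : forall g, zmod_morphism (alg_act g);
  alg_act_monoid : forall g, monoid_morphism (alg_act g);
  alg_act_inalg : forall g (c : k), alg_act g (inalg c) = inalg c;
  alg_act1 : forall a, alg_act 1%g a = a;
  alg_actM : forall g h a, alg_act (g * h)%g a = alg_act g (alg_act h a)
}.

(* A # G; the function f stands for the sum over g of (f g) # g.  The action is
   recorded in the type, as the multiplication depends on it. *)
Definition skew_alg (alpha : alg_action) := {ffun gT -> A}.

Variable alpha : alg_action.

HB.instance Definition _ := GRing.Zmodule.on (skew_alg alpha).

(* The pure tensor a # g. *)
Definition smash (a : A) (g : gT) : skew_alg alpha :=
  [ffun h => if h == g then a else 0].

Definition skew_mul (f h : skew_alg alpha) : skew_alg alpha :=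
  \sum_(g : gT) \sum_(g' : gT) smash (f g * alpha g (h g')) (g * g')%g.

Definition skew_one : skew_alg alpha := smash 1 1%g.

Lemma alg_act0 g : alpha g 0 = 0.
Proof. by have := alg_act_zmod alpha g 0 0; rewrite !subrr. Qed.

Lemma alg_actD g : {morph alpha g : a b / a + b}.
Proof.
move=> a b; rewrite -{1}[b]opprK (alg_act_zmod alpha g a (- b)).
have := alg_act_zmod alpha g 0 b.
by rewrite !sub0r alg_act0 sub0r => ->; rewrite opprK.
Qed.

Lemma alg_act_mul g : {morph alpha g : a b / a * b}.
Proof. exact: (alg_act_monoid alpha g).2. Qed.

Lemma alg_act_one g : alpha g 1 = 1.
Proof. exact: (alg_act_monoid alpha g).1. Qed.

Lemma alg_act_sum g (I : Type) (r : seq I) (P : pred I) (F : I -> A) :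
  alpha g (\sum_(i <- r | P i) F i) = \sum_(i <- r | P i) alpha g (F i).
Proof. exact: (big_morph _ (alg_actD g) (alg_act0 g)). Qed.

Lemma smashD g : {morph smash^~ g : a b / a + b}.
Proof.
by move=> a b; apply/ffunP => h; rewrite !ffunE; case: eqP; rewrite ?addr0.
Qed.

Lemma smash0 g : smash 0 g = 0.
Proof. by apply/ffunP => h; rewrite !ffunE; case: eqP. Qed.

Lemma skew_sum_smash (f : skew_alg alpha) : f = \sum_g smash (f g) g.
Proof.
apply/ffunP => h; rewrite sum_ffunE (bigD1 h) //= big1 => [|g /negPf gh].
  by rewrite ffunE eqxx addr0.
by rewrite ffunE eq_sym gh.
Qed.

Fact skew_mulDl : left_distributive skew_mul +%R.
Proof.
move=> f1 f2 h; rewrite /skew_mul -big_split; apply: eq_bigr => g _ /=.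
by rewrite -big_split; apply: eq_bigr => g' _ /=; rewrite !ffunE mulrDl smashD.
Qed.

Fact skew_mulDr : right_distributive skew_mul +%R.
Proof.
move=> h f1 f2; rewrite /skew_mul -big_split; apply: eq_bigr => g _ /=.
rewrite -big_split; apply: eq_bigr => g' _ /=.
by rewrite !ffunE alg_actD mulrDr smashD.
Qed.

Lemma skew_mul0l f : skew_mul 0 f = 0.
Proof.
rewrite /skew_mul big1 // => g _; rewrite big1 // => g' _.
by rewrite ffunE mul0r smash0.
Qed.

Lemma skew_mul0r f : skew_mul f 0 = 0.
Proof.
rewrite /skew_mul big1 // => g _; rewrite big1 // => g' _.
by rewrite ffunE alg_act0 mulr0 smash0.
Qed.

(* The defining multiplication rule (a # g)(b # h) = a g(b) # gh. *)
Lemma smashM a g b h :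
  skew_mul (smash a g) (smash b h) = smash (a * alpha g b) (g * h)%g.
Proof.
rewrite /skew_mul (bigD1 g) //= [X in _ + X]big1 ?addr0 => [|g1 /negPf g1g].
  rewrite (bigD1 h) //= [X in _ + X]big1 ?addr0 => [|h1 /negPf h1h].
    by rewrite !ffunE !eqxx.
  by rewrite !ffunE h1h alg_act0 mulr0 smash0.
by rewrite big1 // => h1 _; rewrite !ffunE g1g mul0r smash0.
Qed.

Lemma skew_mul_suml (I : Type) (r : seq I) (F : I -> skew_alg alpha) h :
  skew_mul (\sum_(i <- r) F i) h = \sum_(i <- r) skew_mul (F i) h.
Proof.
exact: (big_morph (skew_mul^~ h) (fun _ _ => skew_mulDl _ _ _) (skew_mul0l h)).
Qed.

Lemma skew_mul_sumr (I : Type) (r : seq I) (F : I -> skew_alg alpha) h :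
  skew_mul h (\sum_(i <- r) F i) = \sum_(i <- r) skew_mul h (F i).
Proof.
exact: (big_morph (skew_mul h) (fun _ _ => skew_mulDr _ _ _) (skew_mul0r h)).
Qed.

Fact skew_mulA : associative skew_mul.
Proof.
move=> f1 f2 f3.
rewrite (skew_sum_smash f1) (skew_sum_smash f2) (skew_sum_smash f3).
rewrite !skew_mul_suml; apply: eq_bigr => g1 _.
rewrite [LHS]skew_mul_sumr.
rewrite [skew_mul _ (\sum_g smash (f2 g) g)]skew_mul_sumr skew_mul_suml.
apply: eq_bigr => g2 _.
rewrite !skew_mul_sumr; apply: eq_bigr => g3 _.
by rewrite !smashM alg_act_mul alg_actM mulgA mulrA.
Qed.

Fact skew_mul1 : left_id skew_one skew_mul.
Proof.
move=> f; rewrite {2}(skew_sum_smash f) {1}(skew_sum_smash f) skew_mul_sumr.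
by apply: eq_bigr => g _; rewrite smashM alg_act1 mul1r mul1g.
Qed.

Fact skew_mulr1 : right_id skew_one skew_mul.
Proof.
move=> f; rewrite {2}(skew_sum_smash f) {1}(skew_sum_smash f) skew_mul_suml.
by apply: eq_bigr => g _; rewrite smashM alg_act_one mulr1 mulg1.
Qed.

HB.instance Definition _ := GRing.Zmodule_isPzRing.Build (skew_alg alpha)
  skew_mulA skew_mul1 skew_mulr1 skew_mulDl skew_mulDr.

Definition skew_inalg (c : k) : skew_alg alpha := smash (inalg c) 1%g.

Fact skew_inalg_zmod : zmod_morphism skew_inalg.
Proof.
move=> c d; apply/ffunP => h; rewrite !ffunE raddfB.
by case: eqP => _ //; rewrite subr0.
Qed.
Fact skew_inalg_monoid : monoid_morphism skew_inalg.
Proof.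
split=> [|c d]; first by rewrite /skew_inalg rmorph1.
by rewrite [RHS]smashM alg_act1 mulg1 -rmorphM.
Qed.
Fact skew_inalg_central (c : k) (f : skew_alg alpha) :
  skew_inalg c * f = f * skew_inalg c.
Proof.
rewrite (skew_sum_smash f) mulr_sumr mulr_suml; apply: eq_bigr => g _.
rewrite [LHS]smashM [RHS]smashM alg_act1 alg_act_inalg mulg1 mul1g.
by rewrite inalg_central.
Qed.

HB.instance Definition _ := isAssocAlgebra.Build k (skew_alg alpha)
  skew_inalg_zmod skew_inalg_monoid skew_inalg_central.

Definition group_sum : skew_alg alpha := \sum_(g : gT) smash 1 g.

End SkewGroupAlgebra.

Section GelfandKirillov.
Variables (R : realType) (k : fieldType) (A : assocAlgType k).

Definition lspan (S : set A) : set A :=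
  [set v | exists s : seq (k * A),
     (forall p, p \in s -> S p.2) /\ v = \sum_(p <- s) inalg p.1 * p.2].

Definition lin_indep (s : seq A) : Prop :=
  forall c : 'I_(size s) -> k,
    \sum_(i < size s) inalg (c i) * s`_i = 0 -> forall i, c i = 0.

(* Dimension of a linear subspace U, possibly +oo. *)
Definition ldim (U : set A) : \bar R :=
  ereal_sup [set ((size s)%:R)%:E |
    s in [set s : seq A | lin_indep s /\ forall v, v \in s -> U v]].

Definition fin_dim_subspace (W : set A) : Prop :=
  exists s : seq A, W = lspan [set v | v \in s].

(* The subspace W^0 + W^1 + ... + W^n, where W^0 = k. *)
Definition power_sum (W : set A) (n : nat) : set A :=
  lspan [set a | exists t : seq A,
    [/\ (size t <= n)%N, forall w, w \in t -> W w & a = \prod_(w <- t) w]].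

(* GKdim A is the supremum, over finite-dimensional subspaces W of A, of
   limsup_n log_n dim (W^0 + ... + W^n).  As lne 0 = -oo, the zero algebra
   has GKdim -oo; the terms n = 0, 1 do not affect the limsup. *)
Definition GKdim : \bar R :=
  ereal_sup [set limn_esup (fun n : nat =>
      (lne (ldim (power_sum W n)) / lne (n%:R%:E))%E) |
    W in [set W : set A | fin_dim_subspace W]].

End GelfandKirillov.

Definition pertinency (R : realType) (k : fieldType) (A : assocAlgType k)
    (gT : finGroupType) (alpha : alg_action A gT) : \bar R :=
  (GKdim R A - GKdim R (alg_quot [set group_sum alpha]))%E.

Section FreeAlgebra.
Variables (k : fieldType) (m : nat).

(* Free algebra on 'I_m: the algebra of the free monoid. *)
Definition free_alg := malg (fmonom 'I_m) k.

HB.instance Definition _ := GRing.NzRing.on free_alg.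

Definition free_inalg (c : k) : free_alg := mkmalgU mone c.
Definition free_gen (i : 'I_m) : free_alg := mkmalgU (fmu i) 1.

Lemma monUM c d (u v : fmonom 'I_m) :
  (mkmalgU u c : free_alg) * mkmalgU v d = mkmalgU (mmul u v) (c * d).
Proof. exact: fgmulUU. Qed.

Lemma free_alg_ind (P : free_alg -> Prop) :
  P 0 -> (forall a b, P a -> P b -> P (a + b)) ->
  (forall c w, P (mkmalgU w c)) -> forall a, P a.
Proof.
move=> P0 PD PU a; rewrite (monalgE a).
by elim/big_ind: _ => // w _; apply: PU.
Qed.

Fact free_inalg_zmod : zmod_morphism free_inalg.
Proof. exact: raddfB. Qed.
Fact free_inalg_monoid : monoid_morphism free_inalg.
Proof. by split=> // c d; rewrite monUM mul1m. Qed.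
Fact free_inalg_central (c : k) (a : free_alg) :
  free_inalg c * a = a * free_inalg c.
Proof.
elim/free_alg_ind: a => [|a b IHa IHb|d w]; first by rewrite mulr0 mul0r.
  by rewrite mulrDr mulrDl IHa IHb.
by rewrite !monUM mul1m mulm1 mulrC.
Qed.

HB.instance Definition _ := isAssocAlgebra.Build k free_alg
  free_inalg_zmod free_inalg_monoid free_inalg_central.

Section Substitution.
Variable s : 'S_m.

Definition mon_perm (w : fmonom 'I_m) : free_alg :=
  \prod_(i <- fmonom_val w) free_gen (s i).

Fact mon_perm_mmorphism : mmorphism mon_perm.
Proof.
split=> [u v|]; last by rewrite /mon_perm fm1 big_nil.
by rewrite /mon_perm fmM big_cat.
Qed.

HB.instance Definition _ :=
  isMultiplicative.Build (fmonom 'I_m) free_alg mon_perm mon_perm_mmorphism.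

Definition free_perm (a : free_alg) : free_alg :=
  mmap (@inalg k free_alg) mon_perm a.

Lemma free_permU c w : free_perm (mkmalgU w c) = inalg c * mon_perm w.
Proof. exact: mmapU. Qed.

Fact free_perm_zmod : zmod_morphism free_perm.
Proof. exact: mmapB. Qed.
Fact free_perm_monoid : monoid_morphism free_perm.
Proof.
suff [hM h1] : multiplicative free_perm by split.
by apply: commr_mmap_is_multiplicative => a u v; apply: inalg_central.
Qed.

HB.instance Definition _ :=
  GRing.isZmodMorphism.Build free_alg free_alg free_perm free_perm_zmod.
HB.instance Definition _ :=
  GRing.isMonoidMorphism.Build free_alg free_alg free_perm free_perm_monoid.

Lemma free_perm_inalg c : free_perm (inalg c) = inalg c.
Proof. by rewrite free_permU /mon_perm fm1 big_nil mulr1. Qed.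

Lemma free_perm_gen i : free_perm (free_gen i) = free_gen (s i).
Proof.
by rewrite free_permU rmorph1 mul1r /mon_perm fmuE big_seq1.
Qed.

End Substitution.

Lemma mon_perm1 w : mon_perm 1 w = mkmalgU w 1.
Proof.
case: w => l; rewrite /mon_perm /=; elim: l => [|i l IHl].
  by rewrite big_nil -fmoneE.
rewrite big_cons IHl perm1 monUM mulr1; congr mkmalgU.
by rewrite /mmul /= fmmulE fmuE.
Qed.

Lemma free_perm1 a : free_perm 1 a = a.
Proof.
elim/free_alg_ind: a => [|a b IHa IHb|c w]; first exact: raddf0.
  by rewrite raddfD /= IHa IHb.
by rewrite free_permU mon_perm1 monUM mul1m mulr1.
Qed.

Lemma free_permM s t a : free_perm (s * t) a = free_perm t (free_perm s a).
Proof.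
elim/free_alg_ind: a => [|a b IHa IHb|c w]; first by rewrite !raddf0.
  by rewrite !raddfD /= IHa IHb.
rewrite !free_permU rmorphM /= free_perm_inalg rmorph_prod; congr (_ * _).
by apply: eq_bigr => i _; rewrite /= free_perm_gen permM.
Qed.

End FreeAlgebra.

Section SkewPolynomial.
Variables (k : fieldType) (m : nat).

Definition V_rel : set (free_alg k m) :=
  [set r | exists i j : 'I_m,
     i != j /\ r = free_gen k i * free_gen k j + free_gen k j * free_gen k i].

(* The (-1)-skew polynomial algebra V_m; its generators are indexed from 0. *)
Definition V_alg : assocAlgType k := alg_quot V_rel.

Definition V_gen (i : 'I_m) : V_alg := qpi V_rel (free_gen k i).

Definition V_perm (s : 'S_m) (v : V_alg) : V_alg :=
  qpi V_rel (free_perm s (qrepr v)).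

Lemma free_perm_ideal s a :
  ideal_gen V_rel a -> ideal_gen V_rel (free_perm s a).
Proof.
have [h0 hB hl hr] := ideal_gen_ideal V_rel.
move/ideal_genP/(_ [set x | ideal_gen V_rel (free_perm s x)]).
apply=> [|r [i [j [ij ->]]]].
  split=> [|x y Ix Iy|b x Ix|b x Ix] /=.
  - by rewrite raddf0.
  - by rewrite free_perm_zmod; exact: hB Ix Iy.
  - by rewrite (free_perm_monoid _ s).2; exact: hl Ix.
  - by rewrite (free_perm_monoid _ s).2; exact: hr Ix.
rewrite /= (raddfD (free_perm s)) /=.
rewrite [X in X + _](free_perm_monoid _ s).2.
rewrite [X in _ + X](free_perm_monoid _ s).2.
rewrite 2!free_perm_gen.
apply/ideal_genP => I _; apply; exists (s i), (s j).
by rewrite (inj_eq perm_inj).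
Qed.

Lemma V_perm_pi s a : V_perm s (qpi V_rel a) = qpi V_rel (free_perm s a).
Proof.
apply/qpi_eq/ideal_predP; rewrite -raddfB; apply: free_perm_ideal.
by apply/ideal_predP/qpi_eq; rewrite qreprK.
Qed.

Lemma V_perm_gen s i : V_perm s (V_gen i) = V_gen (s i).
Proof. by rewrite V_perm_pi free_perm_gen. Qed.

Fact V_perm_zmod s : zmod_morphism (V_perm s).
Proof.
move=> u v; rewrite -[u]qreprK -[v]qreprK.
by rewrite -qpi_zmod !V_perm_pi -qpi_zmod -free_perm_zmod.
Qed.

Fact V_perm_monoid s : monoid_morphism (V_perm s).
Proof.
split=> [|u v]; first by rewrite [LHS]V_perm_pi rmorph1.
rewrite -[u]qreprK -[v]qreprK -(qpi_monoid V_rel).2 !V_perm_pi.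
by rewrite (free_perm_monoid _ s).2 (qpi_monoid V_rel).2.
Qed.

Fact V_perm_inalg s (c : k) : V_perm s (inalg c) = inalg c.
Proof. by rewrite [LHS]V_perm_pi free_perm_inalg. Qed.

Lemma V_perm1 v : V_perm 1 v = v.
Proof. by rewrite /V_perm free_perm1 qreprK. Qed.

(* Products in 'S_m are read from left to right: (s * t) i = t (s i). *)
Lemma V_permM s t v : V_perm (s * t) v = V_perm t (V_perm s v).
Proof. by rewrite -[v]qreprK !V_perm_pi free_permM. Qed.

(* The action of the cyclic group generated by s; as this group is abelian, the
   order of composition is immaterial. *)
Section CyclicAction.
Variable s : 'S_m.

Definition cycle_act (g : subg_of <[s]>%G) (v : V_alg) : V_alg :=
  V_perm (sgval g) v.

Fact cycle_act1 v : cycle_act 1%g v = v.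
Proof. exact: V_perm1. Qed.

Fact cycle_actM g h v :
  cycle_act (g * h)%g v = cycle_act g (cycle_act h v).
Proof.
have -> : (g * h)%g = (h * g)%g.
  apply: val_inj; apply: (centsP (cycle_abelian s)); exact: subgP.
exact: (V_permM (sgval h) (sgval g) v).
Qed.

Definition cycle_action : alg_action V_alg (subg_of <[s]>%G) :=
  AlgAction (fun g => V_perm_zmod (sgval g)) (fun g => V_perm_monoid (sgval g))
    (fun g => V_perm_inalg (sgval g)) cycle_act1 cycle_actM.

End CyclicAction.

End SkewPolynomial.

Fact pair_fst_subproof n (i : 'I_n) : (2 * i < 2 * n)%N.
Proof. by rewrite ltn_pmul2l. Qed.

Fact pair_snd_subproof n (i : 'I_n) : (2 * i + 1 < 2 * n)%N.
Proof. by rewrite addn1 !mul2n ltn_Sdouble. Qed.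

(* The permutation (1 2)(3 4)...(2n-1 2n), on indices shifted down by 1. *)
Definition paired_transpositions (n : nat) : 'S_(2 * n) :=
  (\prod_(i < n) tperm (Ordinal (pair_fst_subproof i))
                       (Ordinal (pair_snd_subproof i)))%g.

(* Main.v *)
Require Import Defs.
From mathcomp Require Import all_boot all_order all_algebra all_fingroup.
From mathcomp Require Import cyclic boolp classical_sets reals ereal topology.
From mathcomp Require Import normedtype sequences exp.
From mathcomp Require Import -(notations) monalg.

(* In the quotient of A # <s> by (1 # 1 + 1 # s) the element 1 # s becomes -1,
   so the result is a quotient of A in which a and s(a) are identified.  For
   A = V_m and s an involution without fixed points, the images z_i of the
   generators anticommute and satisfy z_i = z_{s(i)} with s(i) <> i, hence
   2 z_i^2 = 0: words with a repeated letter vanish, and the quotient is finite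
   dimensional.  It is nonzero because the augmentation x_i |-> 0, s |-> -1
   factors through it; so its GK dimension is 0.

   V_m itself has GK dimension m.  Every word is up to sign a sorted word, which
   gives at most (N+1)^m independent words of length at most N; sorted words are
   independent because counting words with the sign of their inversions is a
   linear form on the free algebra that kills the defining relations. *)

Set Implicit Arguments.
Unset Strict Implicit.
Unset Printing Implicit Defensive.

Import Order.TTheory GRing.Theory Num.Theory.
Import numFieldTopology.Exports numFieldNormedType.Exports.

Local Open Scope classical_set_scope.
Local Open Scope ring_scope.

(** * Polynomial growth and bounds on the GK dimension *)

Section GrowthRate.
Variable R : realType.

Lemma near_le_limn_esup (u v : (\bar R)^nat) :
  (\forall n \near \oo, (u n <= v n)%E) -> (limn_esup u <= limn_esup v)%E.
Proof.
move=> uv; rewrite /limn_esup !limf_esupE.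
apply: le_ereal_inf_tmp => /= _ [A FA <-].
(* Intersecting [A] with the set where [u n <= v n] stays inside the filter and allows a termwise
   comparison. *)
apply: (@le_trans _ _ (ereal_sup (u @` (A `&` [set n | (u n <= v n)%E])))).
  apply: ereal_inf_lbound; exists (A `&` [set n | (u n <= v n)%E]) => //.
  exact: filterI.
apply: ge_ereal_sup => _ [n [An unv] <-].
by apply: (le_trans unv); apply: ereal_sup_ubound; exists n.
Qed.

Lemma cvg_inv_ln : ((ln (n%:R : R))^-1 : R^o) @[n --> \oo] --> (0 : R^o).
Proof.
apply/gtr0_cvgV0.
  near=> n; apply: ln_gt0; rewrite ltr1n; near: n; exact: nbhs_infty_gt.
apply/cvgryPge => M; near=> n.
rewrite -[M]expRK ler_ln ?posrE ?expR_gt0 //.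
  near: n; exact: nbhs_infty_ger.
rewrite ltr0n; near: n; exact: nbhs_infty_gt.
Unshelve. all: by end_near. Qed.

(** For [n > 1] the ratio is [d + ln K / ln n], whose second summand tends to 0: a constant factor
    does not change the growth exponent. *)
Lemma limn_esup_log_poly (K : R) (d : nat) : 0 < K ->
  limn_esup (fun n : nat => (lne (K * n%:R ^+ d)%:E / lne (n%:R%:E))%E) =
  (d%:R%:E : \bar R).
Proof.
move=> K0.
have lim : (d%:R + ln K * (ln n%:R)^-1 : R^o) @[n --> \oo] --> (d%:R : R^o).
  (* The limit is put in the form [d + ln K * 0]; the same rewriting also hits the function, which
     is then restored. *)
  rewrite -(addr0 (d%:R : R^o)) -(mulr0 (ln K : R^o)).
  rewrite [X in fmap X _](_ : _ =
      fun n => (d%:R : R^o) + ln K * (ln n%:R)^-1); last first.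
    by apply/funext => n; rewrite mulr0 addr0.
  by apply: cvgD; [exact: cvg_cst|apply: cvgMr; exact: cvg_inv_ln].
have le : (lne (K * n%:R ^+ d)%:E / lne (n%:R%:E))%E @[n --> \oo] -->
    (d%:R%:E : \bar R).
  have : ((d%:R + ln K * (ln n%:R)^-1)%:E @[n --> \oo] --> (d%:R%:E : \bar R)).
    by apply: cvg_EFin; [exact: nearW|exact: lim].
  apply: cvg_trans; apply: near_eq_cvg; near=> n.
  have n1 : (1 < n)%N by near: n; exact: nbhs_infty_gt.
  have n0 : (0 : R) < n%:R by rewrite ltr0n ltnW.
  have ln0 : 0 < ln (n%:R : R) by rewrite ln_gt0 // ltr1n.
  rewrite !lne_EFin ?mulr_gt0 ?exprn_gt0 // inver gt_eqF // -EFinM; congr EFin.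
  rewrite lnM ?posrE ?exprn_gt0 // lnXn // mulrDl addrC; congr (_ + _).
  by rewrite -(mulr_natl (ln _)) mulfK // gt_eqF.
by have [_ ->] := cvg_limn_einf_sup le.
Unshelve. all: by end_near. Qed.

Lemma lne_ratio_le (x y : \bar R) (n : nat) : (1 < n)%N -> (0 <= x)%E ->
  (x <= y)%E -> (lne x / lne (n%:R%:E) <= lne y / lne (n%:R%:E))%E.
Proof.
move=> n1 x0 xy.
have n0 : (0 : R) < n%:R by rewrite ltr0n ltnW.
have ln0 : 0 < ln (n%:R : R) by rewrite ln_gt0 // ltr1n.
rewrite [lne n%:R%:E]lne_EFin // inver gt_eqF //; apply: lee_wpmul2r.
  by rewrite lee_fin invr_ge0 ltW.
by rewrite lee_lne // in_itv /= ?leey ?andbT // (le_trans x0).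
Qed.

Variables (k : fieldType) (A : assocAlgType k).

Lemma ldim_ge0 (U : set A) : (0 <= ldim R U)%E.
Proof.
apply: ereal_sup_ubound; exists [::] => //=; split=> // c _ [].
by [].
Qed.

(** The constant may depend on [W], because it disappears in the limit. *)
Lemma GKdim_le (d : nat) :
  (forall W : set A, fin_dim_subspace W -> exists2 K : R, 0 < K &
     forall n, (0 < n)%N -> (ldim R (power_sum W n) <= (K * n%:R ^+ d)%:E)%E) ->
  (GKdim R A <= d%:R%:E)%E.
Proof.
move=> h; apply: ge_ereal_sup => _ [W /h [K K0 hK] <-].
rewrite -(limn_esup_log_poly d K0); apply: near_le_limn_esup.
(* From 2 on [ln n] is positive, so dividing by it preserves the order. *)
exists 2 => // n n1; apply: (lne_ratio_le n1); first exact: ldim_ge0.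
by apply: hK; exact: ltnW.
Qed.

Lemma GKdim_ge (d : nat) (W : set A) (K : R) : fin_dim_subspace W -> 0 < K ->
  (forall n, (0 < n)%N -> ((K * n%:R ^+ d)%:E <= ldim R (power_sum W n))%E) ->
  (d%:R%:E <= GKdim R A)%E.
Proof.
move=> hW K0 h; apply: (@le_trans _ _ (limn_esup (fun n : nat =>
  (lne (ldim R (power_sum W n)) / lne (n%:R%:E))%E))).
  rewrite -(limn_esup_log_poly d K0); apply: near_le_limn_esup.
  exists 2 => // n n1; apply: (lne_ratio_le n1).
    by rewrite lee_fin mulr_ge0 ?exprn_ge0 // ltW.
  by apply: h; exact: ltnW.
by apply: ereal_sup_ubound; exists W.
Qed.

End GrowthRate.

(** * Linear spans and linear dimension *)

Lemma inalg_mul_eq0 (k : fieldType) (A : assocAlgType k) (c : k) (a : A) :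
  c != 0 -> inalg c * a = 0 -> a = 0.
Proof.
by move=> c0 ca; rewrite -[a]mul1r -(rmorph1 (@inalg k A)) -(mulVf c0) rmorphM
  -mulrA ca mulr0.
Qed.

Section LinearSpan.
Variables (k : fieldType) (A : assocAlgType k).
Implicit Types (S U W : set A).

Definition subspace U : Prop :=
  [/\ U 0, forall x y, U x -> U y -> U (x + y)
    & forall (c : k) x, U x -> U (inalg c * x)].

Lemma subspace_sum U (I : eqType) (r : seq I) (F : I -> A) : subspace U ->
  (forall i, i \in r -> U (F i)) -> U (\sum_(i <- r) F i).
Proof.
move=> [U0 UD _] UF; rewrite big_seq.
by elim/big_ind: _.
Qed.

Lemma sub_lspan S : S `<=` lspan S.
Proof.
move=> v Sv; exists [:: (1, v)]; split; last by rewrite big_seq1 rmorph1 mul1r.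
by move=> p; rewrite inE => /eqP ->.
Qed.

Lemma lspan_subspace S : subspace (lspan S).
Proof.
split.
- by exists [::]; rewrite big_nil.
- move=> x y [s [sS ->]] [t [tS ->]]; exists (s ++ t).
  split; last by rewrite big_cat.
  by move=> p; rewrite mem_cat => /orP[]; [exact: sS|exact: tS].
- move=> c x [s [sS ->]]; exists [seq (c * p.1, p.2) | p <- s]; split.
    by move=> _ /mapP[p ps ->]; exact: (sS p).
  by rewrite big_map mulr_sumr; apply: eq_bigr => p _; rewrite /= rmorphM mulrA.
Qed.

Lemma lspan_min S U : subspace U -> S `<=` U -> lspan S `<=` U.
Proof.
move=> hU SU v [s [sS ->]]; apply: subspace_sum => // p ps.
by case: hU => _ _; apply; apply/SU/sS.
Qed.

(** The list behind [lspan] may repeat vectors; one coefficient per index is what the matrix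
    argument below needs. *)
Lemma lspan_range (I : finType) (b : I -> A) v : lspan (range b) v ->
  exists c : I -> k, v = \sum_i inalg (c i) * b i.
Proof.
apply: (@lspan_min _ [set v | exists c : I -> k, v = \sum_i inalg (c i) * b i]).
  split=> [|x y [c ->] [d ->]|c x [d ->]] /=.
  - by exists (fun=> 0); rewrite big1 // => i _; rewrite raddf0 mul0r.
  - exists (fun i => c i + d i); rewrite -big_split; apply: eq_bigr => i _.
    by rewrite /= rmorphD mulrDl.
  - exists (fun i => c * d i); rewrite mulr_sumr; apply: eq_bigr => i _.
    by rewrite rmorphM mulrA.
move=> _ [i _ <-]; exists (fun j => (j == i)%:R).
rewrite (bigD1 i) //= eqxx rmorph1 mul1r big1 ?addr0 // => j /negPf ->.
by rewrite raddf0 mul0r.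
Qed.

(** With more vectors than indices, the matrix of coordinates has a nonzero left kernel vector,
    which is a linear dependence. *)
Lemma lin_indep_size_le (I : finType) (b : I -> A) (s : seq A) : lin_indep s ->
  (forall v, v \in s -> lspan (range b) v) -> (size s <= #|I|)%N.
Proof.
move=> indep sb.
have /choice[c hc] (i : 'I_(size s)) :
    exists c : I -> k, s`_i = \sum_j inalg (c j) * b j.
  by apply/lspan_range/sb/mem_nth.
rewrite leqNgt; apply/negP => lt_I_s.
pose M : 'M[k]_(size s, #|I|) := \matrix_(i, j) c i (enum_val j).
have /rowV0Pn[u /sub_kermxP uM /negP] : kermx M != 0.
  rewrite -mxrank_eq0 mxrank_ker subn_eq0 -ltnNge.
  exact: leq_ltn_trans (rank_leq_col M) lt_I_s.
apply; apply/eqP/rowP => i; rewrite mxE.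
apply: (indep (fun i => u 0 i)).
under eq_bigr => j _ do rewrite hc mulr_sumr.
rewrite exchange_big big1 //= => j _.
under eq_bigr => l _ do rewrite mulrA -rmorphM.
rewrite -mulr_suml -rmorph_sum.
have := congr1 (fun v : 'rV_ _ => v 0 (enum_rank j)) uM.
rewrite !mxE; under eq_bigr => l _ do rewrite mxE enum_rankK.
by move=> ->; rewrite raddf0 mul0r.
Qed.

Lemma ldim_lspan_le (R : realType) (I : finType) (b : I -> A) U :
  U `<=` lspan (range b) -> (ldim R U <= #|I|%:R%:E)%E.
Proof.
move=> Ub; apply: ge_ereal_sup => _ [s [indep sU] <-].
rewrite lee_fin ler_nat; apply: (lin_indep_size_le indep) => v /sU; exact: Ub.
Qed.

Lemma ldim_size_ge (R : realType) (s : seq A) U : lin_indep s ->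
  (forall v, v \in s -> U v) -> ((size s)%:R%:E <= ldim R U)%E.
Proof. by move=> indep sU; apply: ereal_sup_ubound; exists s. Qed.

Lemma GKdim_fin_le0 (R : realType) (I : finType) (b : I -> A) :
  (forall a, lspan (range b) a) -> (GKdim R A <= 0)%E.
Proof.
move=> spanb; apply: (@GKdim_le R k A 0) => W _.
(* The successor keeps the constant positive when [I] is empty. *)
exists #|I|.+1%:R => [|n _]; first by rewrite ltr0n.
rewrite expr0 mulr1; apply: (@le_trans _ _ #|I|%:R%:E).
  by apply: ldim_lspan_le => a _; exact: spanb.
by rewrite lee_fin ler_nat.
Qed.

Lemma GKdim_neq0_ge0 (R : realType) : (1 : A) != 0 -> (0 <= GKdim R A)%E.
Proof.
(* The zero subspace suffices: its power sums contain the empty product 1, which is independent. *)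
move=> A1; apply: (@GKdim_ge R k A 0 (lspan [set v | v \in [::]]) 1) => //.
  by exists [::].
move=> n _; rewrite expr0 mulr1.
apply: (@ldim_size_ge R [:: 1]) => [c|v].
  rewrite /= big_ord1 /= mulr1 => c0 i; rewrite ord1; apply/eqP.
  by apply: contraNT A1 => c_neq0; apply/eqP/(inalg_mul_eq0 c_neq0);
    rewrite mulr1.
rewrite inE => /eqP ->; apply: sub_lspan; exists [::]; split=> //.
by rewrite big_nil.
Qed.

End LinearSpan.

(** * Words in anticommuting generators *)

Section Words.
Variables (k : fieldType) (A : assocAlgType k) (m : nat) (x : 'I_m -> A).
Implicit Types (w : seq 'I_m) (a : 'I_m -> nat) (W : set A).

Definition word w : A := \prod_(i <- w) x i.

Lemma word_nil : word [::] = 1.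
Proof. exact: big_nil. Qed.

Lemma word_cons i w : word (i :: w) = x i * word w.
Proof. exact: big_cons. Qed.

Lemma word_cat w1 w2 : word (w1 ++ w2) = word w1 * word w2.
Proof. exact: big_cat. Qed.

(** The filtration by word length. Generation of [A] by the [x i] is expressed by the hypothesis
    [gen], that it exhausts [A]. *)
Definition word_span d : set A :=
  lspan [set v | exists2 w, (size w <= d)%N & v = word w].

Lemma word_span_subspace d : subspace (word_span d).
Proof. exact: lspan_subspace. Qed.

Lemma word_spanW d e : (d <= e)%N -> word_span d `<=` word_span e.
Proof.
move=> de; apply: lspan_min; first exact: lspan_subspace.
by move=> _ [w wd ->]; apply: sub_lspan; exists w => //; exact: leq_trans de.
Qed.

Lemma word_spanM d e u v :
  word_span d u -> word_span e v -> word_span (d + e) (u * v).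
Proof.
have [S0 SD SZ] := word_span_subspace (d + e).
move=> + ev; apply: (@lspan_min _ _ _ [set u | word_span (d + e) (u * v)]).
  split=> [|u1 u2 /= h1 h2|c u1 /= h1] /=; first by rewrite mul0r.
    by rewrite mulrDl; exact: SD.
  by rewrite -mulrA; exact: SZ.
move=> _ [w wd ->] /=; move: ev.
apply: (@lspan_min _ _ _ [set v | word_span (d + e) (word w * v)]).
  split=> [|u1 u2 /= h1 h2|c u1 /= h1] /=; first by rewrite mulr0.
    by rewrite mulrDr; exact: SD.
  by rewrite mulrA -inalg_central -mulrA; exact: SZ.
move=> _ [w' we ->] /=; apply: sub_lspan; exists (w ++ w').
  by rewrite size_cat leq_add.
by rewrite word_cat.
Qed.

Lemma word_span1 d : word_span d 1.
Proof. by apply: sub_lspan; exists [::] => //; rewrite word_nil. Qed.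

Hypothesis gen : forall v, exists d, word_span d v.

Lemma fin_dim_word_span W : fin_dim_subspace W -> exists d, W `<=` word_span d.
Proof.
move=> [s ->]; have [f fP] := choice gen.
exists (\max_(v <- s) f v)%N; apply: lspan_min; first exact: lspan_subspace.
by move=> v /= vs; apply: (word_spanW _ (fP v)); exact: leq_bigmax_seq.
Qed.

Lemma power_sum_word_span W d n :
  W `<=` word_span d -> power_sum W n `<=` word_span (d * n).
Proof.
move=> Wd; apply: lspan_min; first exact: lspan_subspace.
move=> _ [t [tn tW ->]]; have : (d * size t <= d * n)%N by rewrite leq_mul.
move/word_spanW; apply; elim: t {tn} tW => [|v t IHt] tW.
  by rewrite big_nil; exact: word_span1.
rewrite big_cons mulnS; apply: word_spanM.
  by apply/Wd/tW; rewrite mem_head.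
by apply: IHt => w wt; apply: tW; rewrite inE wt orbT.
Qed.

(** The sorted word with exponent vector [a], standing for the normal monomial $x_0^{a_0}\cdots
    x_{m-1}^{a_{m-1}}$. *)
Definition exp_word a : seq 'I_m := flatten [seq nseq (a i) i | i <- enum 'I_m].

Lemma count_exp_word a i : count_mem i (exp_word a) = a i.
Proof.
rewrite count_flatten -map_comp sumnE big_map enumT -/(index_enum _).
rewrite (bigD1 i) //= count_nseq /= eqxx mul1n big1 ?addn0 // => j /negPf ji.
by rewrite count_nseq /= ji.
Qed.

Lemma size_exp_word a : size (exp_word a) = (\sum_i a i)%N.
Proof.
rewrite size_flatten /shape -map_comp sumnE big_map enumT -/(index_enum _).
by apply: eq_bigr => i _; rewrite /= size_nseq.
Qed.

Hypothesis anti : forall i j, i != j -> x i * x j = - (x j * x i).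

Lemma mulr_signCA (u v : A) e : u * ((-1) ^+ e * v) = (-1) ^+ e * (u * v).
Proof. by rewrite !mulrA (commr_sign u e). Qed.

(** Passing a different letter costs one sign, passing an equal letter none. The sign stays
    existential since only spans matter here. *)
Lemma word_insert i w1 w2 :
  exists e, x i * word (w1 ++ w2) = (-1) ^+ e * word (w1 ++ i :: w2).
Proof.
elim: w1 => [|j w1 [e IHw]] /=.
  by exists 0%N; rewrite expr0 mul1r word_cons.
rewrite !word_cons mulrA.
have [<-|ij] := eqVneq i j; first by exists e; rewrite -mulrA IHw mulr_signCA.
exists e.+1; rewrite anti // mulNr -mulrA IHw exprS mulN1r mulNr; congr (- _).
by rewrite mulr_signCA.
Qed.

(** The head of [w1] occurs in [w2]; induction treats the remaining letters and [word_insert] puts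
    the head in place. *)
Lemma word_perm w1 w2 : perm_eq w1 w2 ->
  exists e, word w1 = (-1) ^+ e * word w2.
Proof.
elim: w1 w2 => [|i w1 IHw] w2 w12.
  by exists 0%N; rewrite expr0 mul1r; move: w12;
    rewrite perm_sym => /perm_nilP ->.
have /path.splitPr w2i : i \in w2 by rewrite -(perm_mem w12) mem_head.
case: w2i w12 => u v; rewrite perm_sym -cat1s perm_catCA perm_cons perm_sym =>
  /IHw[e we].
have [f wf] := word_insert i u v.
exists (e + f)%N; rewrite word_cons we mulr_signCA wf.
by rewrite exprD mulrA.
Qed.

(** A word of length at most [d] has exponents at most [d] and equals its sorted form up to sign. *)
Lemma word_span_exp d : word_span d `<=`
  lspan (range (fun a : {ffun 'I_m -> 'I_d.+1} =>
    word (exp_word (fun i => a i)))).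
Proof.
apply: lspan_min; first exact: lspan_subspace.
move=> _ [w wd ->]; pose a := [ffun i => inord (count_mem i w) : 'I_d.+1].
have [|e ->] := @word_perm w (exp_word (fun i => a i)).
  apply/allP => i _ /=; rewrite count_exp_word ffunE inordK //.
  by rewrite ltnS (leq_trans (count_size _ _)).
rewrite -(rmorph1 (@inalg k A)) -rmorphN -rmorphXn.
have [_ _ SZ] := lspan_subspace
  (range (fun a : {ffun 'I_m -> 'I_d.+1} => word (exp_word (fun i => a i)))).
by apply: SZ; apply: sub_lspan; exists a.
Qed.

Lemma GKdim_quasi_commuting_le (R : realType) : (GKdim R A <= m%:R%:E)%E.
Proof.
apply: GKdim_le => W /fin_dim_word_span[d Wd].
(* There are [(d * n + 1) ^ m] exponent vectors, at most [((d + 1) * n) ^ m] because [n >= 1]. *)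
exists (d.+1%:R ^+ m) => [|n n0]; first by rewrite exprn_gt0 // ltr0n.
apply: (@le_trans _ _ #|{ffun 'I_m -> 'I_(d * n).+1}|%:R%:E).
  apply: ldim_lspan_le => v /(power_sum_word_span Wd); exact: word_span_exp.
rewrite lee_fin card_ffun !card_ord natrX -exprMn -natrM lerXn2r ?nnegrE //
  ler_nat.
by rewrite mulSn addnC -addn1 leq_add.
Qed.

End Words.

(** Exponents at most [n %/ m] give words of length at most [n], and there are
    [(n %/ m + 1) ^ m >= (n / m) ^ m] of them. *)
Lemma GKdim_indep_words_ge (R : realType) (k : fieldType) (A : assocAlgType k)
    (m : nat) (x : 'I_m -> A) : (0 < m)%N ->
  (forall q, lin_indep
    [seq word x (exp_word (fun i => a i)) | a : {ffun 'I_m -> 'I_q}]) ->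
  (m%:R%:E <= GKdim R A)%E.
Proof.
move=> m0 indep.
apply: (@GKdim_ge R k A m (lspan [set v | v \in codom x]) (m%:R^-1 ^+ m)).
- by exists (codom x).
- by rewrite exprn_gt0 // invr_gt0 ltr0n.
move=> n n0; rewrite -exprMn.
apply: le_trans (ldim_size_ge R (indep (n %/ m).+1) _); last first.
  move=> _ /mapP[a _ ->]; apply: sub_lspan.
  exists [seq x i | i <- exp_word (fun i => a i)]; split.
  - rewrite size_map size_exp_word.
    rewrite (@leq_trans (\sum_(i < m) n %/ m)) ?leq_sum // => [i _|].
      by rewrite -ltnS.
    by rewrite sum_nat_const card_ord mulnC leq_divM.
  - by move=> _ /mapP[i _ ->]; apply: sub_lspan; exact: codom_f.
  - by rewrite /word big_map.
rewrite size_image card_ffun !card_ord lee_fin natrX lerXn2r ?nnegrE ?mulr_ge0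
  ?invr_ge0 //.
by rewrite mulrC ler_pdivrMr ?ltr0n // -natrM ler_nat ltnW // ltn_ceil.
Qed.

(** * Additive maps vanishing on a two-sided ideal *)

Lemma zmod_morphismD (U V : zmodType) (f : U -> V) :
  zmod_morphism f -> {morph f : x y / x + y}.
Proof.
move=> fB x y; have f0 : f 0 = 0 by have := fB 0 0; rewrite !subrr.
by rewrite -{1}[y]opprK fB -[- y]sub0r fB f0 sub0r opprK.
Qed.

Lemma qpi_eq0 (k : fieldType) (A : assocAlgType k) (S : set A) (x : A) :
  qpi S x = 0 <-> ideal_gen S x.
Proof.
rewrite -[x in ideal_gen _ x]subr0 -(raddf0 (qpi S)).
by split=> [/qpi_eq/ideal_predP|/ideal_predP/qpi_eq].
Qed.

Lemma sub_ideal_gen (k : fieldType) (A : assocAlgType k) (S : set A) :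
  S `<=` ideal_gen S.
Proof. by move=> x Sx; apply/ideal_genP => I _; apply. Qed.

Lemma qpi_inalgM (k : fieldType) (A : assocAlgType k) (S : set A) (c : k)
    (x : A) :
  qpi S (inalg c * x) = inalg c * qpi S x.
Proof. exact: qpiM. Qed.

(** The [x] with [f (u * x * v) = 0] for all [u], [v] form a two-sided ideal. By additivity [u] and
    [v] need only range over additive generators [B], which enter through their induction
    principle. *)
Lemma ideal_gen_ker (k : fieldType) (A : assocAlgType k) (V : zmodType)
    (S B : set A) (f : A -> V) : {morph f : x y / x - y} ->
  (forall P : A -> Prop, P 0 -> (forall x y, P x -> P y -> P (x + y)) ->
     (forall b, B b -> P b) -> forall x, P x) ->
  (forall u v r, B u -> B v -> S r -> f (u * r * v) = 0) ->
  forall x, ideal_gen S x -> f x = 0.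
Proof.
move=> fB Bind fS x /ideal_genP/(_ [set x | forall u v, f (u * x * v) = 0]) h.
have fD := zmod_morphismD fB.
have f0 : f 0 = 0 by have := fB 0 0; rewrite !subrr.
rewrite -[x]mul1r -[_ * x]mulr1; apply: h => [|r Sr u v].
  split=> [u v|y z hy hz u v|a y hy u v|a y hy u v] /=.
  - by rewrite mulr0 mul0r.
  - by rewrite mulrBr mulrBl fB hy hz subrr.
  - by rewrite mulrA hy.
  - by rewrite mulrA -mulrA hy.
elim/Bind: u => [|u u' hu hu'|u Bu]; first by rewrite !mul0r.
  by rewrite !mulrDl fD hu hu' addr0.
elim/Bind: v => [|v v' hv hv'|v Bv]; first by rewrite !mulr0.
  by rewrite !mulrDr fD hv hv' addr0.
exact: fS.
Qed.

(* Rewriting by ring laws inside [free_alg] sends unification into unfolding the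
   monoid algebra; the next two lemmas take the relevant terms as arguments. *)
Lemma mulr_sandwich (A : pzRingType) (u a b v p q r : A) :
  a * b = p -> u * p = q -> q * v = r -> u * (a * b) * v = r.
Proof. by move=> <- <- <-. Qed.

Lemma morph_sandwichD (A : pzRingType) (V : nmodType) (f : A -> V) :
  {morph f : x y / x + y} -> forall u a b v p q : A,
  u * a * v = p -> u * b * v = q -> f (u * (a + b) * v) = f p + f q.
Proof. by move=> fD u a b v p q <- <-; rewrite mulrDr mulrDl fD. Qed.

(** * Independence of sorted words in the skew polynomial algebra *)

Section SkewPolynomialWords.
Variables (k : fieldType) (m : nat).
Implicit Types (w : seq 'I_m) (x : free_alg k m).

Fixpoint inversions w : nat :=
  if w is i :: w' then (count (fun j : 'I_m => (j < i)%N) w' + inversions w')%N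
  else 0%N.

(** The swapped pair is an inversion in exactly one of the two orders; all other contributions
    agree, because counts ignore the order of letters. *)
Lemma odd_inversions_swap w1 w2 i j : i != j ->
  odd (inversions (w1 ++ i :: j :: w2)) =
    ~~ odd (inversions (w1 ++ j :: i :: w2)).
Proof.
move=> ij; elim: w1 => [|l w1 IHw] /=.
  rewrite !oddD !oddb; case: (ltngtP i j) ij => [||/val_inj->];
    rewrite ?eqxx //= => _ _; by do 3 case: (odd _).
rewrite !oddD IHw addbN; congr (~~ (odd _ (+) _)).
by rewrite !count_cat /=; congr (_ + _)%N; exact: addnCA.
Qed.

Definition monomial (c : k) w : free_alg k m := mkmalgU (FMonom w) c.

Lemma monomialM c d w1 w2 :
  monomial c w1 * monomial d w2 = monomial (c * d) (w1 ++ w2).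
Proof. by rewrite /monomial monUM /mmul /= fmmulE. Qed.

Lemma free_genE i : free_gen k i = monomial 1 [:: i].
Proof. by rewrite /monomial -fmuE. Qed.

Lemma inalg_monomial c : inalg c = monomial c [::].
Proof. by rewrite /monomial -fmoneE. Qed.

Lemma monomial_ind (P : free_alg k m -> Prop) : P 0 ->
  (forall x y, P x -> P y -> P (x + y)) -> (forall c w, P (monomial c w)) ->
  forall x, P x.
Proof. by move=> P0 PD PM; apply: free_alg_ind => // c [w]; exact: PM. Qed.

(* The coefficient in x of the word w0 up to reordering, each word counted with
   the sign picked up when its letters are sorted. *)
Definition signed_coef w0 x : k :=
  mmap idfun (fun w : fmonom 'I_m =>
    if perm_eq w w0 then (-1) ^+ inversions w else 0) x.

Lemma signed_coefB w0 : {morph signed_coef w0 : x y / x - y}.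
Proof. exact: mmapB. Qed.

Lemma signed_coefD w0 : {morph signed_coef w0 : x y / x + y}.
Proof. exact: mmapD. Qed.

Lemma signed_coef0 w0 : signed_coef w0 0 = 0.
Proof. exact: mmap0. Qed.

Lemma signed_coef_monomial w0 c w : signed_coef w0 (monomial c w) =
  c * (if perm_eq w w0 then (-1) ^+ inversions w else 0).
Proof. exact: mmapU. Qed.

Local Opaque monomial signed_coef.

Lemma word_monomial w : word (@free_gen k m) w = monomial 1 w.
Proof.
elim: w => [|i w IHw]; first by rewrite word_nil -inalg_monomial rmorph1.
by rewrite word_cons IHw free_genE monomialM mulr1.
Qed.

Lemma inalg_word (c : k) w : inalg c * word (@free_gen k m) w = monomial c w.
Proof. by rewrite word_monomial inalg_monomial monomialM mulr1. Qed.

Lemma qpi_monomial c w :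
  qpi (@V_rel k m) (monomial c w) = inalg c * word (@V_gen k m) w.
Proof. by rewrite -inalg_word qpi_inalgM /word rmorph_prod. Qed.

Lemma V_gen_anti (i j : 'I_m) : i != j ->
  V_gen k i * V_gen k j = - (V_gen k j * V_gen k i).
Proof.
move=> ij; apply/eqP; rewrite -addr_eq0 /V_gen -!rmorphM -rmorphD; apply/eqP.
by apply/qpi_eq0; apply: sub_ideal_gen; exists i, j.
Qed.

Lemma V_word_span (v : V_alg k m) : exists d, word_span (@V_gen k m) d v.
Proof.
rewrite -[v]qreprK; elim/monomial_ind: (qrepr v) => [|a b [d hd] [e he]|c w].
- exists 0%N; rewrite raddf0.
  by have [] := word_span_subspace (@V_gen k m) 0.
- exists (maxn d e); rewrite raddfD.
  have [_ SD _] := word_span_subspace (@V_gen k m) (maxn d e).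
  by apply: SD; [apply: word_spanW hd|apply: word_spanW he];
    rewrite ?leq_maxl ?leq_maxr.
- exists (size w); rewrite qpi_monomial.
  have [_ _ SZ] := word_span_subspace (@V_gen k m) (size w).
  by apply/SZ/sub_lspan; exists w.
Qed.

(** The two terms of the relation have the same letters and opposite inversion parity, so their
    contributions cancel. *)
Lemma signed_coef_rel w0 i j c d w1 w2 : i != j ->
  signed_coef w0 (monomial c w1 *
    (free_gen k i * free_gen k j + free_gen k j * free_gen k i) *
    monomial d w2) = 0.
Proof.
move=> ij.
have E (l l' : 'I_m) :
    monomial c w1 * (free_gen k l * free_gen k l') * monomial d w2 =
    monomial (c * (1 * 1) * d) ((w1 ++ [:: l; l']) ++ w2).
  rewrite !free_genE.
  exact: mulr_sandwich (monomialM 1 1 [:: l] [:: l']) (monomialM _ _ _ _)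
    (monomialM _ _ _ _).
apply: etrans (morph_sandwichD (signed_coefD w0) (E i j) (E j i)) _.
rewrite !signed_coef_monomial !mulr1 -!catA /= -mulrDr.
have -> : perm_eq (w1 ++ j :: i :: w2) w0 = perm_eq (w1 ++ i :: j :: w2) w0.
  by apply: (permPl _); rewrite perm_cat2l -(cat1s i) -(cat1s j) perm_catCA.
case: ifP => _; last by rewrite addr0 mulr0.
rewrite -[in X in X + _]signr_odd odd_inversions_swap // signrN signr_odd addNr.
by rewrite mulr0.
Qed.

(** Hence the signed coefficient descends to [V_alg], where it separates words with different letter
    multiplicities. *)
Lemma signed_coef_ideal w0 x : ideal_gen (@V_rel k m) x -> signed_coef w0 x = 0.
Proof.
apply: (@ideal_gen_ker _ _ _ _ [set b | exists c w, b = monomial c w] _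
  (signed_coefB w0)) => {x} [P P0 PD PM|
    _ _ _ [c [w1 ->]] [d [w2 ->]] [i [j [ij ->]]]].
  by apply: monomial_ind => // c w; apply: PM; exists c, w.
exact: signed_coef_rel.
Qed.

(** The signed coefficient at the [j]-th word turns a vanishing combination into [c j] up to sign,
    as no other word of the list is a rearrangement of it. *)
Lemma lin_indep_V_words (ws : seq (seq 'I_m)) :
  pairwise (fun w w' => ~~ perm_eq w w') ws ->
    lin_indep (map (word (@V_gen k m)) ws).
Proof.
move=> /(pairwiseP [::]) wsP c c0 j.
have [jn inj] : (j < size ws)%N /\ forall i, (i < size ws)%N ->
    perm_eq (nth [::] ws i) (nth [::] ws j) = (i == j).
  have jn : (j < size ws)%N by rewrite -(size_map (word (@V_gen k m))).
  split=> // i ilt; have [->|] := eqVneq i j; first exact: perm_refl.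
  rewrite neq_ltn => /orP[] lt; apply/negbTE; first exact: wsP.
  by rewrite perm_sym; exact: wsP.
(* The lift of the vanishing combination to the free algebra; it lies in the ideal of relations. *)
pose x : free_alg k m := \sum_(i < size (map (word (@V_gen k m)) ws))
  monomial (c i) (nth [::] ws i).
have : signed_coef (nth [::] ws j) x = 0.
  apply/signed_coef_ideal/qpi_eq0; rewrite -c0 /x rmorph_sum;
    apply: eq_bigr => i _.
  rewrite [LHS]qpi_monomial (nth_map [::]) //.
  by rewrite -(size_map (word (@V_gen k m))).
rewrite /x (big_morph _ (signed_coefD _) (signed_coef0 _)) (bigD1 j) //= big1.
  rewrite addr0 signed_coef_monomial perm_refl => /eqP.
  by rewrite mulf_eq0 signr_eq0 orbF => /eqP.
move=> i ij; rewrite signed_coef_monomial inj.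
  by rewrite val_eqE (negbTE ij) mulr0.
by rewrite -(size_map (word (@V_gen k m))).
Qed.

End SkewPolynomialWords.

Lemma GKdim_V (R : realType) (k : fieldType) (m : nat) : (0 < m)%N ->
  GKdim R (V_alg k m) = m%:R%:E.
Proof.
move=> m0; apply/le_anti/andP; split.
  apply: GKdim_quasi_commuting_le; [exact: V_word_span|exact: V_gen_anti].
apply: (@GKdim_indep_words_ge R k _ m (@V_gen k m)) => // q.
rewrite (_ : fintype.image_mem _ _ = map (word (@V_gen k m))
  [seq exp_word (fun i => a i) | a : {ffun 'I_m -> 'I_q}]);
    last by rewrite -map_comp.
apply: lin_indep_V_words.
(* Letter counts recover the exponents, so distinct exponent vectors give words that are not
   rearrangements of each other. *)
rewrite pairwise_map; apply: (@sub_pairwise _ (fun a b => a != b)); last first.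
  by rewrite -uniq_pairwise enum_uniq.
move=> a b; apply: contra => /seq.permP ab; apply/eqP/ffunP => i; apply/val_inj.
by have := ab (pred1 i); rewrite !count_exp_word.
Qed.

(** * The quotient of the skew group algebra for a group of order two *)

Section OrderTwoQuotient.
Variables (k : fieldType) (A : assocAlgType k) (gT : finGroupType).
Variables (alpha : alg_action A gT) (g0 : gT).
Hypothesis g0_neq1 : g0 != 1%g.
Hypothesis gP : forall g : gT, g = 1%g \/ g = g0.

Local Notation B := (alg_quot [set group_sum alpha]).
Local Notation pi := (qpi [set group_sum alpha]).

Lemma skewM (a b : A) (g h : gT) :
  smash alpha a g * smash alpha b h = smash alpha (a * alpha g b) (g * h)%g.
Proof. exact: smashM. Qed.

Lemma group_sumE : group_sum alpha = smash alpha 1 1%g + smash alpha 1 g0.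
Proof.
rewrite /group_sum (bigD1 1%g) //= (bigD1 g0) //= big1 ?addr0 //.
move=> g /andP[g1 gg0].
by case: (gP g) g1 gg0 => ->; rewrite eqxx.
Qed.

Definition base_quot (a : A) : B := pi (smash alpha a 1%g).

Lemma base_quotD : {morph base_quot : a b / a + b}.
Proof. by move=> a b; rewrite /base_quot smashD raddfD. Qed.

Lemma base_quotM : {morph base_quot : a b / a * b}.
Proof.
move=> a b; rewrite /base_quot -[RHS]rmorphM; congr pi.
by rewrite [RHS]skewM alg_act1 mulg1.
Qed.

Lemma base_quot0 : base_quot 0 = 0.
Proof. by rewrite /base_quot smash0 raddf0. Qed.

Lemma base_quot1 : base_quot 1 = 1.
Proof. exact: rmorph1. Qed.

Lemma quot_g0 : pi (smash alpha 1 g0) = -1.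
Proof.
apply/eqP; rewrite -addr_eq0 addrC -(rmorph1 pi) -raddfD; apply/eqP/qpi_eq0.
by apply: sub_ideal_gen; rewrite /= group_sumE.
Qed.

Lemma base_quot_smash (a : A) : pi (smash alpha a g0) = - base_quot a.
Proof.
have -> : smash alpha a g0 = smash alpha a 1%g * smash alpha 1 g0.
  by rewrite skewM alg_act1 mulr1 mul1g.
by rewrite rmorphM [X in _ * X]quot_g0 mulrN1.
Qed.

Lemma base_quot_surj (b : B) : exists a, b = base_quot a.
Proof.
(* Since [1 # g0] becomes -1, the class of [a # 1 + a' # g0] is that of [a - a']. *)
exists (qrepr b 1%g - qrepr b g0).
rewrite -{1}[b]qreprK {1}(skew_sum_smash (qrepr b)).
rewrite (bigD1 1%g) //= (bigD1 g0) //= big1 ?addr0; last first.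
  move=> g /andP[g1 gg0]; by case: (gP g) g1 gg0 => ->; rewrite eqxx.
rewrite raddfD base_quotD; congr (_ + _); rewrite [LHS]base_quot_smash.
apply/eqP; rewrite eq_sym -addr_eq0 -base_quotD addNr.
by rewrite base_quot0.
Qed.

(** In [A # G], [(1 # g0)(a # 1) = g0(a) # g0]; both sides are then read in the quotient with
    [1 # g0] equal to -1. *)
Lemma base_quot_act (a : A) : base_quot (alpha g0 a) = base_quot a.
Proof.
apply: oppr_inj; rewrite -!base_quot_smash.
have -> : smash alpha (alpha g0 a) g0 = smash alpha 1 g0 * smash alpha a 1%g.
  by rewrite skewM mul1r mulg1.
by rewrite rmorphM [X in X * _]quot_g0 mulN1r base_quot_smash.
Qed.

(** An invariant character of [A], extended by the sign character of the group, kills the group sum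
    but not 1. *)
Lemma quot_neq0 (eps : A -> k) : {morph eps : a b / a - b} -> eps 1 = 1 ->
  {morph eps : a b / a * b} -> (forall g a, eps (alpha g a) = eps a) ->
  (1 : B) != 0.
Proof.
move=> epsB eps1 epsM eps_act; apply/eqP.
move=> /(qpi_eq0 [set group_sum alpha] 1)/=.
have eps0 : eps 0 = 0 by have := epsB 0 0; rewrite !subrr.
(* The extension of [eps] that sends [1 # g0] to -1. *)
pose F (f : skew_alg alpha) := eps (f 1%g) - eps (f g0).
have FB : {morph F : x y / x - y}.
  by move=> x y; rewrite /F !ffunE !epsB !opprD !opprK addrACA.
have F1 x : F (smash alpha x 1%g) = eps x.
  by rewrite /F !ffunE eqxx (negbTE g0_neq1) eps0 subr0.
have F2 x : F (smash alpha x g0) = - eps x.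
  by rewrite /F !ffunE eqxx eq_sym (negbTE g0_neq1) eps0 sub0r.
have FD := zmod_morphismD FB.
move/(@ideal_gen_ker _ _ _ _
  [set b | exists a g, b = smash alpha a g] F FB) => F10.
have : F 1 = 0.
  apply: F10 => [P P0 PD PB x|_ _ _ [a [g ->]] [b [h ->]] ->].
    rewrite (skew_sum_smash x); elim/big_ind: _ => // g _.
    by apply: PB; exists (x g), g.
  have g00 : (g0 * g0 = 1)%g.
    case: (gP (g0 * g0)%g) => // /eqP.
    by rewrite -[X in _ == X]mulg1 (inj_eq (mulgI g0)) (negbTE g0_neq1).
  rewrite group_sumE mulrDr mulrDl FD !skewM.
  by case: (gP g) => ->; case: (gP h) => ->;
    rewrite ?(mulg1, mul1g, g00) ?F1 ?F2 !epsM !eps_act ?eps1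
      !mulr1 ?subrr ?addNr.
by rewrite F1 eps1 => /eqP; rewrite oner_eq0.
Qed.

End OrderTwoQuotient.

(** * The product of disjoint transpositions is a fixed-point-free involution *)

Section PairedTranspositions.
Variable n : nat.
Let fst_of (i : 'I_n) := Ordinal (pair_fst_subproof i).
Let snd_of (i : 'I_n) := Ordinal (pair_snd_subproof i).

Lemma fst_snd_neq i j : fst_of i != snd_of j.
Proof.
rewrite -val_eqE /= addn1 !mul2n; apply/eqP => /(congr1 odd) /=.
by rewrite !odd_double.
Qed.

Lemma fst_of_inj : injective fst_of.
Proof.
by move=> i j /(congr1 val)/=/eqP; rewrite eqn_pmul2l // => /eqP/val_inj.
Qed.

Lemma snd_of_inj : injective snd_of.
Proof.
move=> i j /(congr1 val)/=/eqP; rewrite eqn_add2r eqn_pmul2l // => /eqP.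
exact: val_inj.
Qed.

(** The pairs are disjoint, so only the factor of its own pair moves a point. An arbitrary
    duplicate-free list makes the induction go through. *)
Lemma prod_tpermE (r : seq 'I_n) j : uniq r ->
  ((\prod_(i <- r) tperm (fst_of i) (snd_of i))%g (fst_of j) =
     (if j \in r then snd_of j else fst_of j)) /\
  ((\prod_(i <- r) tperm (fst_of i) (snd_of i))%g (snd_of j) =
     (if j \in r then fst_of j else snd_of j)).
Proof.
elim: r => [|i r IHr] /=; first by rewrite big_nil !perm1.
case/andP=> ir /IHr[IHf IHs]; rewrite big_cons !permM inE.
have [ji|ij] /= := eqVneq j i.
  by subst j; rewrite tpermL tpermR IHf IHs (negbTE ir).
by rewrite !tpermD ?IHf ?IHs ?(inj_eq fst_of_inj) ?(inj_eq snd_of_inj)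
  ?fst_snd_neq // 1?eq_sym ?fst_snd_neq.
Qed.

Lemma pairedE i : paired_transpositions n (fst_of i) = snd_of i /\
  paired_transpositions n (snd_of i) = fst_of i.
Proof.
have [] := prod_tpermE i (index_enum_uniq 'I_n).
by rewrite mem_index_enum.
Qed.

Lemma pair_split (l : 'I_(2 * n)) : exists i, l = fst_of i \/ l = snd_of i.
Proof.
have ln : (l./2 < n)%N by rewrite ltn_half_double -mul2n.
exists (Ordinal ln); have := odd_double_half l; case: (odd l) => /= e;
  [right|left]; by apply/val_inj; rewrite /= -[LHS]e -mul2n addnC ?addn0.
Qed.

Lemma paired_neq l : paired_transpositions n l != l.
Proof.
have [i [] ->] := pair_split l; have [e1 e2] := pairedE i.
  by rewrite e1 eq_sym fst_snd_neq.
by rewrite e2 fst_snd_neq.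
Qed.

Lemma pairedK : involutive (paired_transpositions n).
Proof.
by move=> l; have [i [] ->] := pair_split l; have [e1 e2] := pairedE i;
  rewrite ?(e1, e2).
Qed.

End PairedTranspositions.

Lemma order_fixfree_involution (T : finType) (s : {perm T}) (x : T) :
  s x != x -> involutive s -> #[s]%g = 2.
Proof.
move=> sx sK; apply: nt_prime_order => //.
  by apply/permP => y; rewrite expgS expg1 permM sK perm1.
by apply: contraNneq sx => ->; rewrite perm1.
Qed.

(** The two maps agree on a subspace that contains every word. *)
Lemma eq_on_gen (k : fieldType) (A : assocAlgType k) (m : nat) (x : 'I_m -> A)
    (gen : forall v, exists d, word_span x d v) (L : pzRingType)
    (f g : A -> L) :
  {morph f : a b / a + b} -> {morph g : a b / a + b} ->
  {morph f : a b / a * b} -> {morph g : a b / a * b} ->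
  (forall c, f (inalg c) = g (inalg c)) -> (forall i, f (x i) = g (x i)) ->
  f =1 g.
Proof.
move=> fD gD fM gM fgC fgx v; have [d] := gen v.
apply: (@lspan_min _ _ _ [set v | f v = g v]).
  split=> [|a b /= ha hb|c a /= ha] /=;
    first by rewrite -(raddf0 (@inalg k A)) fgC.
    by rewrite fD gD ha hb.
  by rewrite fM gM fgC ha.
move=> _ [w _ ->] /=; elim: w => [|i w IHw].
  by rewrite word_nil -(rmorph1 (@inalg k A)) fgC.
by rewrite word_cons fM gM fgx IHw.
Qed.

(** * The augmentation of the skew polynomial algebra *)

Section Augmentation.
Variables (k : fieldType) (m : nat).

(** The constant term of a chosen lift; [augmentation_pi] shows that the choice does not matter. *)
Definition augmentation (v : V_alg k m) : k := mcoeff mone (qrepr v).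

(** The constant term is multiplicative on the free algebra and vanishes on generators, hence on the
    relations and their ideal. *)
Lemma augmentation_pi x : augmentation (qpi (@V_rel k m) x) = mcoeff mone x.
Proof.
have [cM c1] := mcoeff1g_is_multiplicative (fmonom 'I_m) k.
have c_gen (i : 'I_m) : mcoeff mone (free_gen k i) = 0.
  by rewrite mcoeffU fm1_eq1.
apply/eqP; rewrite -subr_eq0 -mcoeffB; apply/eqP.
have : ideal_gen (@V_rel k m) (qrepr (qpi (@V_rel k m) x) - x).
  by apply/ideal_predP/qpi_eq; rewrite qreprK.
move/ideal_genP/(_ [set y | mcoeff mone y = 0]); apply.
  split=> [|y z hy hz|a y hy|a y hy] /=.
  - exact: mcoeff0.
  - by rewrite [LHS]mcoeffB hy hz subrr.
  - by rewrite [LHS]cM hy mulr0.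
  - by rewrite [LHS]cM hy mul0r.
move=> _ [i [j [ij ->]]] /=; rewrite [LHS]mcoeffD.
by rewrite [X in X + _]cM [X in _ + X]cM !c_gen mulr0 addr0.
Qed.

Lemma augmentationB : {morph augmentation : u v / u - v}.
Proof.
move=> u v; rewrite -[u]qreprK -[v]qreprK -qpi_zmod !augmentation_pi.
exact: mcoeffB.
Qed.

Lemma augmentationM : {morph augmentation : u v / u * v}.
Proof.
have [cM c1] := mcoeff1g_is_multiplicative (fmonom 'I_m) k.
move=> u v; rewrite -[u]qreprK -[v]qreprK -(qpi_monoid _).2 !augmentation_pi.
exact: cM.
Qed.

Lemma augmentation_inalg c : augmentation (inalg c) = c.
Proof. by rewrite [LHS]augmentation_pi mcoeffUU. Qed.

Lemma augmentation_gen i : augmentation (V_gen k i) = 0.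
Proof. by rewrite [LHS]augmentation_pi mcoeffU fm1_eq1. Qed.

Lemma augmentation1 : augmentation 1 = 1.
Proof. by rewrite -(rmorph1 (@inalg k (V_alg k m))) augmentation_inalg. Qed.

Lemma augmentation_perm (s : 'S_m) v :
  augmentation (V_perm s v) = augmentation v.
Proof.
have VB := @V_perm_zmod k m s; have [_ VM] := @V_perm_monoid k m s.
have VD := zmod_morphismD VB.
apply: (@eq_on_gen k _ m (@V_gen k m) (@V_word_span k m) k
  (augmentation \o V_perm s)).
- by move=> x y /=; rewrite VD; exact: (zmod_morphismD augmentationB).
- exact: (zmod_morphismD augmentationB).
- by move=> x y /=; rewrite VM; exact: augmentationM.
- exact: augmentationM.
- by move=> c /=; rewrite V_perm_inalg.
- by move=> i /=; rewrite V_perm_gen !augmentation_gen.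
Qed.

End Augmentation.

(** * Anticommuting generators with square zero *)

Section SquareZero.
Variables (k : fieldType) (A : assocAlgType k) (m : nat) (x : 'I_m -> A).
Hypothesis gen : forall v, exists d, word_span x d v.
Hypothesis anti : forall i j, i != j -> x i * x j = - (x j * x i).
Hypothesis sq0 : forall i, x i * x i = 0.

(** The left [x i] moves right, with signs, until it meets an equal letter in [w] or at the end;
    there a square appears. *)
Lemma mul_gen_word_gen i w : x i * word x w * x i = 0.
Proof.
elim: w => [|j w IHw]; first by rewrite word_nil mulr1 sq0.
rewrite word_cons mulrA; have [<-|ij] := eqVneq i j;
  first by rewrite sq0 !mul0r.
by rewrite anti // !mulNr -!mulrA [x i * _]mulrA IHw mulr0 oppr0.
Qed.

Lemma word_not_uniq w : ~~ uniq w -> word x w = 0.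
Proof.
elim: w => [|i w IHw] //=; rewrite word_cons negb_and negbK =>
  /orP[/path.splitPr[u v]|/IHw->].
  by rewrite word_cat word_cons !mulrA mul_gen_word_gen mul0r.
exact: mulr0.
Qed.

Lemma GKdim_square_zero_le0 (R : realType) : (GKdim R A <= 0)%E.
Proof.
(* Words without repetition have length at most [m], so sequences of bounded length index a finite
   spanning family. *)
apply: (@GKdim_fin_le0 k A R (m.-bseq 'I_m) (fun w => word x w)) => a.
have [d] := gen a; apply: lspan_min; first exact: lspan_subspace.
move=> _ [w _ ->]; have [/card_uniqP cw|/word_not_uniq ->] := boolP (uniq w).
  have wm : (size w <= m)%N by rewrite -cw -[m in (_ <= m)%N]card_ord max_card.
  by apply: sub_lspan; exists (Bseq wm).
by have [] := lspan_subspace (range (fun w : m.-bseq 'I_m => word x w)).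
Qed.

End SquareZero.

Lemma cycle_order2 (gT : finGroupType) (s : gT) (g : subg_of <[s]>%G) :
  #[s]%g = 2 -> g = 1%g \/ g = subg <[s]>%G s.
Proof.
move=> s2; have : sgval g \in <[s]>%g := subgP g.
rewrite cycle2g // !inE => /orP[] /eqP gE; [left|right]; apply/val_inj => //.
by rewrite /= subgK // cycle_id.
Qed.

(** * Pertinency of a fixed-point-free involution *)

Section FixFreeInvolution.
Variables (R : realType) (k : fieldType) (m : nat) (s : 'S_m).
Hypothesis k2 : 2%:R != 0 :> k.
Hypothesis m_gt0 : (0 < m)%N.
Hypothesis s_fixfree : forall i, s i != i.
Hypothesis sK : involutive s.

Let alpha := cycle_action k s.
Let g0 := subg <[s]>%G s.
Let z i := base_quot alpha (V_gen k i).

Let s2 : #[s]%g = 2.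
Proof. exact: (@order_fixfree_involution _ s (Ordinal m_gt0)). Qed.

Let sg0 : sgval g0 = s.
Proof. by rewrite subgK // cycle_id. Qed.

Let g0_neq1 : g0 != 1%g.
Proof.
apply: contraNneq (s_fixfree (Ordinal m_gt0)) => g01.
by rewrite -sg0 g01 /= perm1.
Qed.

Let gP g : g = 1%g \/ g = g0.
Proof. exact: cycle_order2. Qed.

Let zs i : z (s i) = z i.
Proof.
rewrite /z -[RHS](base_quot_act alpha g0_neq1 gP); congr base_quot.
by rewrite /= /cycle_act sg0 V_perm_gen.
Qed.

Let z_anti i j : i != j -> z i * z j = - (z j * z i).
Proof.
move=> ij; apply/eqP; rewrite -addr_eq0 -!base_quotM -base_quotD.
by rewrite V_gen_anti // addNr base_quot0.
Qed.

Let z_sq0 i : z i * z i = 0.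
Proof.
have zz : z i * z i + z i * z i = 0.
  (* With one factor read as [z (s i)], where [s i != i], anticommutation shows that [z i * z i] is
     its own negative. *)
  by rewrite -[X in _ * X + _]zs z_anti ?zs ?addNr // eq_sym.
have : inalg (2%:R : k) * (z i * z i) = 0.
  by rewrite rmorphMn rmorph1 mulr2n mulrDl mul1r.
exact: inalg_mul_eq0 k2.
Qed.

Let z_gen b : exists d, word_span z d b.
Proof.
have [a ->] := base_quot_surj g0_neq1 gP b; have [d hd] := V_word_span a.
exists d; have [S0 SD SZ] := word_span_subspace z d.
move: a hd; apply: (@lspan_min _ _ _
  [set a | word_span z d (base_quot alpha a)]).
  split=> [|u v /= hu hv|c u /= hu] /=; first by rewrite base_quot0.
    by rewrite base_quotD; exact: SD.
  by rewrite base_quotM; exact: SZ.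
move=> _ [w wd ->] /=; apply: sub_lspan; exists w => //.
by rewrite /word (big_morph _ (base_quotM alpha) (base_quot1 alpha)).
Qed.

Lemma GKdim_fixfree_quot : GKdim R (alg_quot [set group_sum alpha]) = 0%E.
Proof.
apply/le_anti/andP; split.
  exact: GKdim_square_zero_le0 z_gen z_anti z_sq0 R.
apply: GKdim_neq0_ge0.
apply: (quot_neq0 g0_neq1 gP (@augmentationB k m)) => [||g a].
- exact: augmentation1.
- exact: augmentationM.
- exact: augmentation_perm.
Qed.

Lemma pertinency_fixfree : pertinency R alpha = m%:R%:E.
Proof. by rewrite /pertinency GKdim_V // GKdim_fixfree_quot sube0. Qed.

End FixFreeInvolution.

Theorem proposition3p8 (R : realType) (k : closedFieldType)
    (hk : [pchar k] =i pred0) (n : nat) (hn : (1 <= n)%N) :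
  pertinency R (cycle_action k (paired_transpositions n)) = ((2 * n)%:R)%:E.
Proof.
apply: pertinency_fixfree.
(* As 2 is prime, its absence from the characteristic says exactly that it is nonzero in [k]. *)
- by have := hk 2; rewrite !inE /= => /negbT.
- by rewrite muln_gt0.
- exact: paired_neq.
- exact: pairedK.
Qed.
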